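(* (a) $(P_3\times P_2)^{(2)}\in\mathscr{C}_1$. (b) Let $\lambda\ge\mu\ge 2$ and $n=\lambda\mu$. If $\lambda\ge 4$ and $\mu=2$, or if $\lambda\ge\mu\ge 3$, then $(P_\lambda\times P_\mu)(s_1,\dots,s_n)\in\mathscr{C}_0$ for all integers $s_1,\dots,s_n\ge 2$. If $(\lambda,\mu)=(3,2)$, then $(P_\lambda\times P_\mu)(s_1,\dots,s_n)\in\mathscr{C}_0\cup\mathscr{C}_1$ for all integers $s_1,\dots,s_n\ge 2$.
   Context: $P_k$ denotes the path on $k$ vertices; $d(\cdot)$ denotes diameter. For a graph $G$ with vertex set $\{v_1,\dots,v_n\}$ and positive integers $s_1,\dots,s_n$, the vertex-multiplication $G(s_1,\dots,s_n)$ is the graph whose vertex set is a disjoint union $V_1\cup\dots\cup V_n$ with $|V_i|=s_i$, where $u\in V_i$ and $v\in V_j$ are adjacent iff $i\ne j$ and $v_iv_j\in E(G)$; $G^{(s)}=G(s,\dots,s)$. For a connected bridgeless graph $X$, $\bar d(X)$ is the minimum diameter of a strong orientation of $X$. For $j\in\{0,1,2\}$, $\mathscr{C}_j$ is the class of all vertex-multiplications $G(s_1,\dots,s_n)$ of a connected graph $G$ with all $s_i\ge 2$ such that $\bar d(G(s_1,\dots,s_n))=d(G)+j$. The cartesian product $G\times H$ has vertex set $\{\langle u,x\rangle\}$, with $\langle u,x\rangle\langle v,y\rangle$ an edge iff either $u=v$ and $xy\in E(H)$, or $uv\in E(G)$ and $x=y$. *)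

(* Defs.v *)
From HB Require Import structures.
From mathcomp Require Import all_boot.
Set Implicit Arguments.
Unset Strict Implicit.
Unset Printing Implicit Defensive.

(* Finite simple graphs. *)
Record sgraph := SGraph {
  vertex :> finType;
  edge : rel vertex;
  edge_sym : symmetric edge;
  edge_irr : irreflexive edge }.

(* Distance in a digraph [r] (a graph being a symmetric digraph): the least
   length of a walk from [x] to [y].  A shortest walk has fewer than [#|T|]
   arcs, and [dist r x y = #|T|] encodes an infinite distance. *)
Definition walk (T : finType) (r : rel T) (k : nat) (x y : T) : bool :=
  [exists p : k.-tuple T, path r x p && (last x p == y)].

Definition dist (T : finType) (r : rel T) (x y : T) : nat :=
  find (fun k => walk r k x y) (iota 0 #|T|).

Definition diam (T : finType) (r : rel T) : nat :=
  \max_(x : T) \max_(y : T) dist r x y.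

Definition connected (G : sgraph) : Prop :=
  0 < #|G| /\ forall u v : G, connect (@edge G) u v.

(* The path on [k] vertices. *)
Definition path_edge (k : nat) : rel 'I_k :=
  fun i j => (i.+1 == j :> nat) || (j.+1 == i :> nat).

Lemma path_edge_sym k : symmetric (@path_edge k).
Proof. by move=> i j; rewrite /path_edge orbC. Qed.

Lemma path_edge_irr k : irreflexive (@path_edge k).
Proof. by move=> i; rewrite /path_edge orbb gtn_eqF. Qed.

Definition path_graph (k : nat) : sgraph :=
  SGraph (@path_edge_sym k) (@path_edge_irr k).

Definition cart_edge (G H : sgraph) : rel (G * H)%type :=
  fun a b => (a.1 == b.1) && edge a.2 b.2 || edge a.1 b.1 && (a.2 == b.2).

Lemma cart_edge_sym G H : symmetric (@cart_edge G H).
Proof.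
move=> a b; rewrite /cart_edge.
by rewrite (eq_sym a.1) (eq_sym a.2) (edge_sym a.1) (edge_sym a.2).
Qed.

Lemma cart_edge_irr G H : irreflexive (@cart_edge G H).
Proof. by move=> a; rewrite /cart_edge !edge_irr andbF. Qed.

Definition cart (G H : sgraph) : sgraph :=
  SGraph (@cart_edge_sym G H) (@cart_edge_irr G H).

(* The vertex-multiplication [G(s_1, ..., s_n)]: the numbers [s_i] are indexed
   by the vertices of [G] themselves, and the class [V_v] consists of the
   vertices [u] with [tag u = v]. *)
Definition vmult_edge (G : sgraph) (s : G -> nat) : rel {v : G & 'I_(s v)} :=
  fun a b => (tag a != tag b) && edge (tag a) (tag b).

Lemma vmult_edge_sym G s : symmetric (@vmult_edge G s).
Proof. by move=> a b; rewrite /vmult_edge eq_sym edge_sym. Qed.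

Lemma vmult_edge_irr G s : irreflexive (@vmult_edge G s).
Proof. by move=> a; rewrite /vmult_edge eqxx. Qed.

Definition vmult (G : sgraph) (s : G -> nat) : sgraph :=
  SGraph (@vmult_edge_sym G s) (@vmult_edge_irr G s).

Definition orientation (G : sgraph) (D : rel G) : Prop :=
  (forall u v, D u v -> edge u v) /\
  (forall u v, edge u v -> D v u = ~~ D u v).

Definition strong (T : finType) (D : rel T) : Prop :=
  forall u v, connect D u v.

(* [orientation_number X m] says that the minimum diameter of a strong
   orientation of [X] exists and equals [m]; the existence of a strong
   orientation forces [X] to be connected and bridgeless. *)
Definition orientation_number (X : sgraph) (m : nat) : Prop :=
  (exists D : rel X, [/\ orientation D, strong D & diam D = m]) /\
  (forall D : rel X, orientation D -> strong D -> m <= diam D).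

(* [class_C j s] says that the vertex-multiplication [vmult s] of [G] belongs
   to the class C_j. *)
Definition class_C (j : nat) (G : sgraph) (s : G -> nat) : Prop :=
  [/\ connected G, forall v, 2 <= s v &
      orientation_number (vmult s) (diam (@edge G) + j)].

(* Main.v *)
Require Import Defs.
From Stdlib Require Import Classical.
From mathcomp Require Import all_boot zify.
Set Implicit Arguments.
Unset Strict Implicit.
Unset Printing Implicit Defensive.

(* Upper bounds.  An orientation of the 2-fold multiplication of the grid lifts
   to every multiplication with all s_i >= 2, by letting the extra copies of a
   vertex imitate one of the two; this preserves the diameter as soon as every
   vertex lies on a short enough closed walk.  Orient the edges
   (x,y,i)(x+1,y,j) and (x,y,i)(x,y+1,j) upwards iff i = j.  Attaching one more
   column (or row) in this way raises the diameter by at most 1: from a new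
   vertex one can step to the old part and back, which changes the copy index,
   and the new column is crossed in either direction at one arc per step.
   Hence it is enough to correct this orientation near a corner so that the
   3 x 3 and 4 x 2 grids get diameter 4, which is checked by computation.

   Lower bound for the 2-fold P_3 x P_2.  By parity, diameter 3 forces any two
   vertices at even distance to be joined by a walk of exactly 2 arcs, in both
   directions.  Write the grid as the columns a b, f e, c d, where a, c, e form
   one colour class.  Applied to (a,c), this yields a copy f_p with
   a -> f_p -> c -> f_{1-p} -> a; applied to (b,d), a copy e_r with
   b_i -> e_r -> d_i for all i.  Then a 2-walk from c to e_r must use f_{1-p},
   and so must a 2-walk from e_r to a, but these need opposite arcs. *)

(* [reach r k a b]: a walk with at least one and at most [k] arcs; in particular
   [reach r k a a] asks for a closed walk. *)
Inductive reach (T : Type) (r : rel T) : nat -> T -> T -> Prop :=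
| reach_one k a b of r a b : reach r k.+1 a b
| reach_cons k a c b of r a c & reach r k c b : reach r k.+1 a b.

(** * Walks of bounded positive length *)

Section Reach.
Variables (T : Type) (r : rel T).

Lemma reach_mono (r' : rel T) k k' a b :
  subrel r r' -> k <= k' -> reach r k a b -> reach r' k' a b.
Proof.
move=> rr' le_kk' H; elim: H k' le_kk' => {k a b}
  [k a b ab|k a c b ac _ IH] [|k'] // le_kk'.
  exact/reach_one/rr'.
by apply: (reach_cons (rr' _ _ ac)); apply: IH.
Qed.

Lemma reach_trans m n a b c :
  reach r m a b -> reach r n b c -> reach r (m + n) a c.
Proof.
move=> H; elim: H c => {m a b} [k a b ab|k a c b ac _ IH] d bd.
  apply: (reach_cons ab); apply: (reach_mono _ _ bd) => //; exact: leq_addl.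
exact: reach_cons ac (IH _ bd).
Qed.

Lemma reach_sym k a b : symmetric r -> reach r k a b -> reach r k b a.
Proof.
move=> rS; elim=> {k a b} [k a b ab|k a c b ac _ IH].
  by apply: reach_one; rewrite rS.
by rewrite -addn1; apply: (reach_trans IH); apply: reach_one; rewrite rS.
Qed.

Lemma reach_map (T' : Type) (r' : rel T') (f : T -> T') k a b :
  {homo f : x y / r x y >-> r' x y} -> reach r k a b -> reach r' k (f a) (f b).
Proof.
move=> fr; elim=> {k a b} [k a b ab|k a c b ac _ IH].
  exact/reach_one/fr.
exact: reach_cons (fr _ _ ac) IH.
Qed.

(** Every inner vertex of the walk is the target of an arc and so has a preimage under [f]; the two
    ends keep their prescribed preimages. For [f a = f b] a closed walk lifts to a walk between two
    copies. *)
Lemma reach_lift (T' : Type) (r' : rel T') (f : T' -> T) k a b :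
    (forall x y, r x y -> exists z, f z = y) ->
    (forall x y, r (f x) (f y) -> r' x y) ->
  reach r k (f a) (f b) -> reach r' k a b.
Proof.
move=> fsurj fr; move Ea: (f a) => x; move Eb: (f b) => y H.
elim: H a b Ea Eb => {k x y} [k x y xy|k x z y xz _ IH] a b Ea Eb.
  by apply/reach_one/fr; rewrite Ea Eb.
have [c Ec] := fsurj _ _ xz; apply: (@reach_cons _ _ _ _ c); last exact: IH.
by apply: fr; rewrite Ea Ec.
Qed.

End Reach.

(** The nested [if]s restrict the recursive call to actual arcs that do not yet end in [b], also
    under call-by-value evaluation. *)
Fixpoint reachb (T : eqType) (r : rel T) (pts : seq T) k a b : bool :=
  if k is k'.+1 then
    has (fun c => if r a c then
                    if c == b then true else reachb r pts k' c b
                  else false) pts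
  else false.

Lemma reachbP (T : eqType) (r : rel T) pts k a b :
  reachb r pts k a b -> reach r k a b.
Proof.
elim: k a => //= k IH a /hasP[c _]; case ac: (r a c) => //.
case: eqP => [<- _|_ /IH]; [exact: reach_one | exact: reach_cons].
Qed.

(** * Distance and diameter in terms of walks *)

Section Distance.
Variables (T : finType) (r : rel T).

Lemma walkP k x y :
  reflect (exists p, [/\ size p = k, path r x p & last x p = y]) (walk r k x y).
Proof.
apply: (iffP existsP) => [[p /andP[xp /eqP py]]|[p [/eqP pk xp py]]].
  by exists p; rewrite size_tuple.
by exists (Tuple pk); rewrite /= xp py eqxx.
Qed.

Lemma walkS k x y :
  walk r k.+1 x y -> exists2 z, r x z & walk r k z y.
Proof.
case/walkP=> -[|z p] [//= [pk]] /andP[xz zp] py.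
by exists z => //; apply/walkP; exists p.
Qed.

Lemma reach_walk k x y : reach r k x y -> exists2 j, j <= k & walk r j x y.
Proof.
elim=> {k x y} [k x y xy|k x z y xz _ [j jk /walkP[p [pj zp py]]]].
  by exists 1 => //; apply/walkP; exists [:: y]; rewrite /= xy.
by exists j.+1 => //; apply/walkP; exists (z :: p); rewrite /= pj xz zp py.
Qed.

Lemma reach_connect k x y : reach r k x y -> connect r x y.
Proof.
by case/reach_walk=> j _ /walkP[p [_ xp <-]]; apply/connectP; exists p.
Qed.

Lemma dist_le k x y : walk r k x y -> dist r x y <= k.
Proof.
move=> kxy; rewrite leqNgt; apply/negP => lt.
have kT : k < #|T|.
  by apply: (leq_trans lt); rewrite -[leqRHS](size_iota 0) find_size.
by have := before_find 0 lt; rewrite nth_iota // add0n kxy.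
Qed.

Lemma reach_dist k x y : reach r k x y -> dist r x y <= k.
Proof. by case/reach_walk=> j jk /dist_le/leq_trans; apply. Qed.

Lemma dist_walk x y : dist r x y < #|T| -> walk r (dist r x y) x y.
Proof.
move=> lt; have := lt; rewrite -[X in _ < X](size_iota 0) -has_find.
by move/(nth_find 0); rewrite nth_iota.
Qed.

(** A potential that grows by at most 1 per arc bounds the length of every walk from below. The
    bound by [#|T|] covers an infinite distance, encoded as [#|T|]. *)
Lemma dist_lipschitz (f : T -> nat) x y :
    (forall a b, r a b -> f b <= (f a).+1) ->
  f y - f x <= #|T| -> f y - f x <= dist r x y.
Proof.
move=> fr fT; have [lt|/(leq_trans fT)//] := ltnP (dist r x y) #|T|.
have := dist_walk lt; move: (dist r x y) => k {lt fT}.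
elim: k x => [|k IH] x.
  by case/walkP=> -[|z p] [//= _ _ <-]; rewrite subnn.
by case/walkS=> z /fr xz /IH; lia.
Qed.

Lemma diam_le k : (forall x y, dist r x y <= k) -> diam r <= k.
Proof. by move=> H; apply/bigmax_leqP => x _; apply/bigmax_leqP. Qed.

Lemma dist_le_diam x y : dist r x y <= diam r.
Proof.
exact: leq_trans (leq_bigmax (F := dist r x) y)
  (leq_bigmax (F := fun x => \max_y dist r x y) x).
Qed.

End Distance.

(** * Attaching one line of new vertices *)

Section Extension.
Variables (T : Type) (r r' : rel T) (S S' : T -> Prop) (k m : nat).
Variables old new : nat -> bool -> T.
Hypothesis rr' : subrel r r'.
Hypothesis rS : forall a b, S a -> S b -> reach r k a b.
Hypothesis SS' : forall a, S' a -> S a \/ exists2 y, y < m & exists i, a = new y i.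
Hypothesis oldS : forall y i, y < m -> S (old y i).
Hypothesis old_new : forall y i, y < m -> r' (old y i) (new y i).
Hypothesis new_old : forall y i, y < m -> r' (new y i) (old y (~~ i)).
Hypothesis new_up : forall y i, y.+1 < m -> r' (new y i) (new y.+1 i).
Hypothesis new_down : forall y i, y.+1 < m -> r' (new y.+1 i) (new y (~~ i)).

Lemma new_flip y i : y < m -> reach r' 2 (new y i) (new y (~~ i)).
Proof. by move=> ym; apply: (reach_cons (new_old _ ym)); exact/reach_one/old_new. Qed.

Lemma new_upD y d i : y + d.+1 < m -> reach r' d.+1 (new y i) (new (y + d.+1) i).
Proof.
elim: d y => [|d IH] y ym; first by rewrite addn1 in ym *; exact/reach_one/new_up.
apply: (@reach_cons _ _ _ _ (new y.+1 i)); first by apply: new_up; lia.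
by rewrite -addSnnS; apply: IH; lia.
Qed.

Lemma new_downD y d i :
  y + d.+1 < m -> reach r' d.+1 (new (y + d.+1) i) (new y (odd d.+1 (+) i)).
Proof.
elim: d i => [|d IH] i ym; first by rewrite addn1 in ym *; exact/reach_one/new_down.
apply: (@reach_cons _ _ _ _ (new (y + d.+1) (~~ i))).
  by rewrite addnS; apply: new_down; rewrite -addnS.
have -> : odd d.+2 (+) i = odd d.+1 (+) ~~ i by rewrite /= addNb addbN.
by apply: IH; lia.
Qed.

Lemma new_new y y' i j : 3 <= k -> m <= k -> y < m -> y' < m ->
  reach r' k.+1 (new y i) (new y' j).
Proof.
move=> k3 mk ym ym'.
(* Starting from the wrong copy costs one flip of 2 arcs, and [d < m <= k] gives
   [d + 2 <= k + 1]. *)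
have flipped d e : reach r' d (new y e) (new y' j) -> d < m ->
    reach r' k.+1 (new y i) (new y' j).
  move=> H dm; have [<-|ne] := eqVneq e i.
    by apply: (reach_mono _ _ H) => //; lia.
  have Ei : i = ~~ e by case: (i) (e) ne => -[].
  have := new_flip i ym; rewrite {2}Ei negbK => H2.
  by apply: (reach_mono _ _ (reach_trans H2 H)) => //; lia.
case: (ltngtP y y') => [lt|lt|eqy].
- have E : y' = y + (y' - y).-1.+1 by lia.
  apply: (@flipped (y' - y).-1.+1 j); last lia.
  by rewrite {2}E; apply: new_upD; rewrite -E.
- have E : y = y' + (y - y').-1.+1 by lia.
  (* Each step down changes the copy, so the start index is [j] corrected by the parity of the
     number of steps. *)
  apply: (@flipped (y - y').-1.+1 (odd (y - y').-1.+1 (+) j)); last lia.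
  rewrite {2}E -[j in X in reach _ _ _ X](addKb (odd (y - y').-1.+1)).
  by apply: new_downD; rewrite -E.
- rewrite -eqy; have H := new_flip i ym; have [->|ne] := eqVneq j i.
    (* Two flips close up after 4 arcs; this is where [3 <= k] enters. *)
    have := reach_trans H (new_flip (~~ i) ym); rewrite negbK => H4.
    by apply: (reach_mono _ _ H4) => //; lia.
  have -> : j = ~~ i by case: (i) (j) ne => -[].
  by apply: (reach_mono _ _ H) => //; lia.
Qed.

Lemma reach_extend :
  3 <= k -> m <= k -> forall a b, S' a -> S' b -> reach r' k.+1 a b.
Proof.
move=> k3 mk a b /SS' Sa /SS' Sb.
have rS' x y : S x -> S y -> reach r' k x y.
  by move=> Sx Sy; apply: (reach_mono _ _ (rS Sx Sy)).
case: Sa => [Sa|[y ym [i ->]]]; case: Sb => [Sb|[y' ym' [j ->]]].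
- by apply: (reach_mono _ _ (rS Sa Sb)).
- rewrite -addn1; apply: (reach_trans (rS' _ _ Sa (oldS j ym'))).
  exact/reach_one/old_new.
- by apply: (reach_cons (new_old i ym)); apply: rS' => //; apply: oldS.
- exact: new_new.
Qed.

End Extension.

(** * Orientations of the 2-fold grid *)

Definition point := (nat * nat * bool)%type.

Definition in_grid (l m : nat) (a : point) : bool :=
  let: (x, y, _) := a in (x < l) && (y < m).

(** The second and fourth clauses negate the first and third with the ends exchanged, so each edge
    gets exactly one direction. *)
Definition point_arc (h : nat -> nat -> rel bool) : rel point :=
  fun a b => let: (x, y, i) := a in let: (x', y', j) := b in
  [|| [&& y == y', x' == x.+1 & h x y i j],
      [&& y == y', x == x'.+1 & ~~ h x' y' j i],
      [&& x == x', y' == y.+1 & i == j] |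
      [&& x == x', y == y'.+1 & i != j] ].

Definition grid_arc h l m : rel point :=
  fun a b => [&& in_grid l m a, in_grid l m b & point_arc h a b].

(** The case [a = b] asks for short closed walks, which later join different copies of a vertex that
    have the same index. *)
Definition good h l m k : Prop :=
  forall a b, in_grid l m a -> in_grid l m b -> reach (grid_arc h l m) k a b.

Definition grid_points l m : seq point :=
  [seq (x, i) | x <- [seq (x, y) | x <- iota 0 l, y <- iota 0 m], i <- [:: true; false]].

Lemma mem_grid_points l m a : in_grid l m a -> a \in grid_points l m.
Proof.
case: a => [[x y] i] /andP[xl ym]; apply: allpairs_f; last by case: i.
by apply: allpairs_f; rewrite mem_iota.
Qed.

Lemma good_check h l m k :
  (let pts := grid_points l m in
   all (fun a => all (reachb (grid_arc h l m) pts k a) pts) pts) -> good h l m k.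
Proof.
move=> H a b /mem_grid_points Ha /mem_grid_points Hb.
by apply/reachbP; apply: (allP (allP H _ Ha)).
Qed.

(** The edges inside the new column follow [i == j] by definition of [point_arc]; only those joining
    it to column [l.-1] depend on [h]. *)
Lemma good_col h l m k : 0 < l -> 3 <= k -> m <= k ->
    (forall y i j, y < m -> h l.-1 y i j = (i == j)) ->
  good h l m k -> good h l.+1 m k.+1.
Proof.
case: l => // l _ k3 mk hl G.
apply: (reach_extend (m := m) (old := fun y i => (l, y, i))
  (new := fun y i => (l.+1, y, i)) _ G) => //.
- move=> [[x y] i] [[x' y'] j] /and3P[/andP[? ?] /andP[? ?] H].
  by apply/and3P; split; [apply/andP; lia | apply/andP; lia | exact: H].
- move=> [[x y] i] /andP[]; rewrite ltnS leq_eqVlt => /orP[/eqP->|xl] ym.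
    by right; exists y => //; exists i.
  by left; apply/andP.
- by move=> y i ym; apply/andP.
- move=> y i ym; apply/and3P; split; [apply/andP; lia | apply/andP; lia |].
  by rewrite /= !eqxx hl ?eqxx.
- move=> y i ym; apply/and3P; split; [apply/andP; lia | apply/andP; lia |].
  by rewrite /= !eqxx hl //; case: (i); rewrite /= ?orbT.
- move=> y i ym; apply/and3P; split; [apply/andP; lia | apply/andP; lia |].
  by rewrite /= !eqxx !orbT.
- move=> y i ym; apply/and3P; split; [apply/andP; lia | apply/andP; lia |].
  by rewrite /= !eqxx; case: (i); rewrite /= ?orbT.
Qed.

(** Here the roles are exchanged: the edges towards the old rows follow [i == j] by definition, and
    [h] governs those inside the new row [m]. *)
Lemma good_row h l m k : 0 < m -> 3 <= k -> l <= k ->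
    (forall x i j, h x m i j = (i == j)) ->
  good h l m k -> good h l m.+1 k.+1.
Proof.
case: m => // m _ k3 mk hl G.
apply: (reach_extend (m := l) (old := fun x i => (x, m, i))
  (new := fun x i => (x, m.+1, i)) _ G) => //.
- move=> [[x y] i] [[x' y'] j] /and3P[/andP[? ?] /andP[? ?] H].
  by apply/and3P; split; [apply/andP; lia | apply/andP; lia | exact: H].
- move=> [[x y] i] /andP[xl]; rewrite ltnS leq_eqVlt => /orP[/eqP->|ym].
    by right; exists x => //; exists i.
  by left; apply/andP.
- by move=> x i xl; apply/andP.
- move=> x i xl; apply/and3P; split; [apply/andP; lia | apply/andP; lia |].
  by rewrite /= !eqxx !orbT.
- move=> x i xl; apply/and3P; split; [apply/andP; lia | apply/andP; lia |].
  by rewrite /= !eqxx; case: (i); rewrite /= ?orbT.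
- move=> x i xl; apply/and3P; split; [apply/andP; lia | apply/andP; lia |].
  by rewrite /= !eqxx hl eqxx.
- move=> x i xl; apply/and3P; split; [apply/andP; lia | apply/andP; lia |].
  by rewrite /= !eqxx !hl; case: (i); rewrite /= ?orbT.
Qed.

(* [point_arc h] orients the edges of the second coordinate by [i == j] and
   those of the first one by [h]; the exceptions to [i == j] in [h3] and [h4]
   were found by computer search. *)
Definition h3 x y : rel bool := fun i j => (i == j) (+) ((x == y) && (x < 2)).

Definition h4 x y : rel bool :=
  fun i j => if x == y then j else if x == y.+1 then i else i == j.

Lemma good32 : good h3 3 2 4.
Proof. by apply: good_check; vm_compute. Qed.

Lemma good33 : good h3 3 3 4.
Proof. by apply: good_check; vm_compute. Qed.

Lemma good42 : good h4 4 2 4.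
Proof. by apply: good_check; vm_compute. Qed.

Lemma good_l2 l : 4 <= l -> good h4 l 2 l.
Proof.
move=> l4; rewrite -(subnK l4); elim: (l - 4) => [|n IH]; first exact: good42.
rewrite addSn; apply: (good_col _ _ _ _ IH); try lia.
by move=> y i j y2; rewrite /h4 !ifF //; lia.
Qed.

Lemma good_lm l m : 3 <= l -> 3 <= m -> good h3 l m (l + m - 2).
Proof.
move=> l3 m3; rewrite -(subnK m3); elim: (m - 3) => [|n IH].
  (* Columns are added to the 3 x 3 grid first, rows afterwards. All exceptions of [h3] lie at
     [x = y < 2], away from every added line. *)
  rewrite -(subnK l3); elim: (l - 3) => [|n IH]; first exact: good33.
  have -> : n.+1 + 3 + (0 + 3) - 2 = (n + 3 + (0 + 3) - 2).+1 by lia.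
  rewrite addSn; apply: (good_col _ _ _ _ IH); try lia.
  by move=> y i j _; rewrite /h3 [_ && _]negbTE ?addbF //; lia.
have -> : l + (n.+1 + 3) - 2 = (l + (n + 3) - 2).+1 by lia.
rewrite addSn; apply: (good_row _ _ _ _ IH); try lia.
by move=> y i j; rewrite /h3 [_ && _]negbTE ?addbF //; lia.
Qed.

(** * Connectedness and diameter of the grid *)

Lemma path_reach l n (i j : 'I_l) : j = i + n.+1 :> nat -> reach (@path_edge l) n.+1 i j.
Proof.
elim: n i => [|n IH] i ij; first by apply: reach_one; rewrite /path_edge ij addn1 eqxx.
have il : i.+1 < l by have := ltn_ord j; lia.
apply: (@reach_cons _ _ _ _ (Ordinal il)); first by rewrite /path_edge eqxx.
by apply: IH; rewrite /= ij; lia.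
Qed.

Lemma path_reach_neq l (i j : 'I_l) : i != j ->
  exists2 k, k < l & reach (@path_edge l) k i j.
Proof.
case: (ltngtP i j) => [lt|lt|/val_inj->] => [_|_|/eqP//].
  exists (j - i).-1.+1; first by have := ltn_ord j; lia.
  by apply: path_reach; lia.
exists (i - j).-1.+1; first by have := ltn_ord i; lia.
by apply/(reach_sym (@path_edge_sym l))/path_reach; lia.
Qed.

Section Grid.
Variables l m : nat.
Notation grid := (cart (path_graph l) (path_graph m)).

Definition coord_sum (u : grid) : nat := u.1 + u.2.

Lemma edge_coord_sum (u v : grid) :
  edge u v -> coord_sum v = (coord_sum u).+1 \/ coord_sum u = (coord_sum v).+1.
Proof.
case: u v => [x y] [x' y']; rewrite /edge /= /cart_edge /= /path_edge /coord_sum /=.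
by case/orP=> /andP[]; [move=> /eqP<- | move=> + /eqP<-]; case/orP=> /eqP; lia.
Qed.

Hypotheses (l2 : 2 <= l) (m2 : 2 <= m).

Lemma grid_reach (u v : grid) : u != v -> reach (@edge grid) (l + m - 2) u v.
Proof.
case: u v => [x y] [x' y'].
have H k z z' w : reach (@path_edge l) k z z' ->
    reach (@edge grid) k (z, w) (z', w).
  apply: (reach_map (f := fun z : 'I_l => (z, w) : grid)) => a b ab.
  by rewrite /edge /= /cart_edge /= eqxx andbT ab orbT.
have V k z w w' : reach (@path_edge m) k w w' ->
    reach (@edge grid) k (z, w) (z, w').
  apply: (reach_map (f := fun w : 'I_m => (z, w) : grid)) => a b ab.
  by rewrite /edge /= /cart_edge /= eqxx ab.
have [<-|/path_reach_neq[k kl /H xx']] := eqVneq x x'.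
  have [<-|/path_reach_neq[k km /V yy'] _] := eqVneq y y'; first by rewrite eqxx.
  by apply: (reach_mono _ _ (yy' x)) => //; lia.
have [<- _|/path_reach_neq[k' km /V yy'] _] := eqVneq y y'.
  by apply: (reach_mono _ _ (xx' y)) => //; lia.
by apply: (reach_mono _ _ (reach_trans (xx' y) (yy' x'))) => //; lia.
Qed.

Lemma grid_card : l + m - 2 <= #|grid|.
Proof. by rewrite card_prod !card_ord; nia. Qed.

Let l0 : 0 < l. Proof. lia. Qed.
Let m0 : 0 < m. Proof. lia. Qed.
Let l1 : l.-1 < l. Proof. lia. Qed.
Let m1 : m.-1 < m. Proof. lia. Qed.

Definition corner0 : grid := (Ordinal l0, Ordinal m0).
Definition corner1 : grid := (Ordinal l1, Ordinal m1).

Lemma coord_sum_corner : coord_sum corner1 - coord_sum corner0 = l + m - 2.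
Proof. by rewrite /coord_sum /=; lia. Qed.

Lemma grid_diam : diam (@edge grid) = l + m - 2.
Proof.
apply/eqP; rewrite eqn_leq; apply/andP; split.
  apply: diam_le => u v; have [<-|/grid_reach/reach_dist//] := eqVneq u v.
  apply: leq_trans (dist_le (k := 0) _) _ => //.
  by apply/walkP; exists [::].
apply: leq_trans (dist_le_diam _ corner0 corner1).
rewrite -coord_sum_corner; apply: dist_lipschitz.
  by move=> a b /edge_coord_sum; lia.
by rewrite coord_sum_corner grid_card.
Qed.

Lemma grid_connected : connected grid.
Proof.
split=> [|u v]; first by apply/card_gt0P; exists corner0.
by have [<-|/grid_reach/reach_connect] := eqVneq u v; first exact: connect0.
Qed.

(** * Orientations of the vertex-multiplications of the grid *)

Variable s : grid -> nat.
Hypothesis s2 : forall v, 2 <= s v.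
Notation X := (vmult s).

(** The coordinate sum changes by 1 along every arc and differs by [l + m - 2] between copies of
    opposite corners. *)
Lemma vmult_diam_ge (D : rel X) : orientation D -> l + m - 2 <= diam D.
Proof.
case=> DE _; have s0 v : 0 < s v by apply: ltnW.
pose emb v : X := Tagged (fun v => 'I_(s v)) (Ordinal (s0 v)).
apply: leq_trans (dist_le_diam _ (emb corner0) (emb corner1)).
have -> : l + m - 2 = coord_sum (tag (emb corner1)) - coord_sum (tag (emb corner0)).
  by rewrite coord_sum_corner.
apply: (dist_lipschitz (f := fun u => coord_sum (tag u))).
  by move=> a b /DE/andP[_ /edge_coord_sum[]->] //; apply: leqW; apply: leqW.
rewrite coord_sum_corner; apply: leq_trans grid_card _.
by apply: (@leq_card _ _ emb) => u v /(congr1 tag).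
Qed.

(** Copy 0 of a vertex gets index [true]; all further copies share [false]. *)
Definition layer (u : X) : point := (val (tag u).1, val (tag u).2, val (tagged u) == 0).

Lemma vmult_edgeE (u v : X) : edge u v = edge (tag u) (tag v).
Proof.
rewrite -[LHS]/(vmult_edge u v) /vmult_edge; case: eqP => [->|//].
by rewrite edge_irr.
Qed.

Lemma layer_arc h (u v : X) : point_arc h (layer u) (layer v) -> edge u v.
Proof.
rewrite vmult_edgeE; case: u v => [[x y] i] [[x' y'] j].
rewrite /layer /edge /= /cart_edge /= /path_edge /= -!val_eqE /=.
by case/or4P=> /and3P[/eqP-> /eqP-> _]; rewrite !eqxx ?orbT ?andbT ?orbT.
Qed.

Lemma point_arc_flip h (u v : X) : edge u v ->
  point_arc h (layer v) (layer u) = ~~ point_arc h (layer u) (layer v).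
Proof.
rewrite vmult_edgeE; case: u v => [[x y] i] [[x' y'] j].
rewrite /layer /edge /= /cart_edge /= /path_edge /= -!val_eqE /=.
move: (\val i == 0) (\val j == 0) => e f {i j}.
have neqS n : (n == n.+1) = false by rewrite ltn_eqF.
have neqSS n : (n == n.+2) = false by rewrite ltn_eqF.
by case/orP=> /andP[]; [move=> /eqP-> | move=> + /eqP->];
  case/orP=> /eqP<-; rewrite !eqxx ?eqSS !(neqS, neqSS) /=
    ?andbF /= ?orbF ?negbK //; case: e f => -[].
Qed.

Lemma good_orientation h k : good h l m k ->
  exists D : rel X, [/\ orientation D, strong D & diam D <= k].
Proof.
move=> G; exists (fun u v => point_arc h (layer u) (layer v)).
have R u v : reach (fun u v : X => point_arc h (layer u) (layer v)) k u v.
  apply: (reach_lift (r := grid_arc h l m) (f := layer)).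
  - move=> _ [[x y] i] /and3P[_ /andP[xl ym] _].
    (* As a number, [~~ i] is 0 for [true] and 1 for [false], a copy with index [i]; it exists since
       every class has at least 2 vertices. *)
    have is2 : ~~ i < s (Ordinal xl, Ordinal ym) by apply: leq_trans (s2 _); case: (i).
    exists (Tagged (fun v => 'I_(s v)) (Ordinal is2)).
    by rewrite /layer /=; case: (i).
  - by move=> x y /and3P[].
  - by apply: G; rewrite /= !ltn_ord.
split.
- split=> u v; [exact: layer_arc | exact: point_arc_flip].
- by move=> u v; apply: reach_connect (R u v).
- by apply: diam_le => u v; apply: reach_dist.
Qed.

Lemma diam_class0 (D : rel X) :
  orientation D -> strong D -> diam D <= l + m - 2 -> class_C 0 s.
Proof.
move=> Dor Dst Dk; split=> //; first exact: grid_connected.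
rewrite addn0 grid_diam; split=> [|D' /vmult_diam_ge //].
by exists D; split=> //; apply/eqP; rewrite eqn_leq Dk vmult_diam_ge.
Qed.

Lemma good_class0 h : good h l m (l + m - 2) -> class_C 0 s.
Proof. by case/good_orientation=> D [Dor Dst]; apply: diam_class0. Qed.

Lemma good_class1 h : good h l m (l + m - 2).+1 ->
    (forall D : rel X, orientation D -> strong D -> l + m - 2 < diam D) ->
  class_C 1 s.
Proof.
move=> /good_orientation[D [Dor Dst Dk]] lt; split=> //; first exact: grid_connected.
rewrite addn1 grid_diam; split=> //.
by exists D; split=> //; apply/eqP; rewrite eqn_leq Dk lt.
Qed.

(** By excluded middle, either some strong orientation attains the diameter of the grid, or all of
    them exceed it and [h] attains the next value. *)
Lemma good_class01 h : good h l m (l + m - 2).+1 -> class_C 0 s \/ class_C 1 s.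
Proof.
move=> G; have [[D [Dor Dst Dk]]|N] :=
    classic (exists D : rel X, [/\ orientation D, strong D & diam D <= l + m - 2]).
  by left; apply: (diam_class0 Dor).
right; apply: (good_class1 G) => D Dor Dst; rewrite ltnNge; apply/negP => Dk.
by apply: N; exists D.
Qed.

End Grid.

(** * No orientation of diameter 3 for the 2-fold [P_3 x P_2] *)

Section P3P2.

Notation grid := (cart (path_graph 3) (path_graph 2)).
Notation X := (vmult (fun _ : grid => 2)).

Definition pt (x y : nat) (i : bool) : X :=
  Tagged (fun _ : grid => 'I_2) (i := (inord x : 'I_3, inord y : 'I_2)) (inord i : 'I_2).

Definition adj (x y x' y' : nat) : bool :=
  (x == x') && ((y.+1 == y') || (y'.+1 == y)) ||
  ((x.+1 == x') || (x'.+1 == x)) && (y == y').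

Lemma pt_surj (w : X) : exists x y i, [/\ x < 3, y < 2 & w = pt x y i].
Proof.
case: w => [[x y] i]; exists x, y, (i == 1 :> nat); split=> //.
rewrite /pt !inord_val; congr existT; apply: val_inj; rewrite /= inordK.
  by case: i => -[|[|]].
by case: eqP.
Qed.

Lemma edge_pt x y i x' y' j : x < 3 -> y < 2 -> x' < 3 -> y' < 2 ->
  edge (pt x y i) (pt x' y' j) = adj x y x' y'.
Proof.
move=> ? ? ? ?; rewrite vmult_edgeE.
by rewrite /edge /= /cart_edge /= /path_edge -!val_eqE /= !inordK.
Qed.

Lemma sum_pt x y i : x < 3 -> y < 2 -> coord_sum (tag (pt x y i)) = x + y.
Proof. by move=> ? ?; rewrite /coord_sum /= !inordK. Qed.

Lemma pt_inj x y i j : pt x y i = pt x y j -> i = j.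
Proof.
move=> /(congr1 (fun u : X => val (tagged u))) /=.
by rewrite !inordK; case: i; case: j.
Qed.

Variable D : rel X.
Hypothesis Dor : orientation D.
Hypothesis D3 : diam D <= 3.

Lemma walk_parity k u v : walk D k u v ->
  odd (coord_sum (tag v)) = odd k (+) odd (coord_sum (tag u)).
Proof.
elim: k u => [|k IH] u; first by case/walkP=> -[|? ?] [//= _ _ ->].
case/walkS=> w /(proj1 Dor); rewrite vmult_edgeE => uw /IH->.
by case: (edge_coord_sum uw) => -> /=; rewrite ?addbN ?addNb ?negbK.
Qed.

Lemma two_step u v : u != v -> odd (coord_sum (tag u)) = odd (coord_sum (tag v)) ->
  exists2 w, D u w & D w v.
Proof.
move=> uv par; have d3 : dist D u v <= 3 := leq_trans (dist_le_diam D u v) D3.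
(* This makes a value of [dist] up to 3 a true distance, not the code for infinity. Then 0 is
   excluded by [u != v], and 1 and 3 by parity. *)
have X3 : 3 < #|X|.
  apply: (@leq_trans #|grid|); first by rewrite card_prod !card_ord.
  by apply: (@leq_card _ _ (fun x : grid => pt x.1 x.2 true)) => -[x y] [x' y']
    /(congr1 tag) /=; rewrite !inord_val.
have := dist_walk (leq_ltn_trans d3 X3); case: (dist D u v) d3 => [|[|[|[|//]]]] _.
- by case/walkP=> -[|? ?] [//= _ _ E]; rewrite E eqxx in uv.
- by move/walk_parity; rewrite par; case: odd.
- by case/walkS=> w uw /walkS[w' ww' /walkP[[|? ?] [//= _ _ <-]]]; exists w.
- by move/walk_parity; rewrite par; case: odd.
Qed.

Lemma two_step_pt x y i x' y' j : x < 3 -> y < 2 -> x' < 3 -> y' < 2 ->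
    (x != x') || (y != y') -> odd (x + y) = odd (x' + y') ->
  exists x'' y'' k, [/\ x'' < 3, y'' < 2, adj x y x'' y'' && adj x'' y'' x' y',
    D (pt x y i) (pt x'' y'' k) & D (pt x'' y'' k) (pt x' y' j)].
Proof.
move=> x3 y2 x3' y2' ne par; have [||w uw wv] := @two_step (pt x y i) (pt x' y' j).
- apply: contraL ne => /eqP/(congr1 tag) /= [/(congr1 val) + /(congr1 val)].
  by rewrite /= !inordK // => -> ->; rewrite !eqxx.
- by rewrite !sum_pt.
have [x'' [y'' [k [x3'' y2'' Ew]]]] := pt_surj w; exists x'', y'', k.
rewrite -(edge_pt i k) // -(edge_pt k j) // -Ew; split=> //.
by rewrite !(proj1 Dor).
Qed.

Local Notation a := (pt 0 0).
Local Notation c := (pt 2 0).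
Local Notation e := (pt 1 1).
Local Notation b := (pt 0 1).
Local Notation d := (pt 2 1).
Local Notation f := (pt 1 0).

Lemma D_flip x y i x' y' j : x < 3 -> y < 2 -> x' < 3 -> y' < 2 ->
  adj x y x' y' -> D (pt x' y' j) (pt x y i) = ~~ D (pt x y i) (pt x' y' j).
Proof. by move=> *; apply: (proj2 Dor); rewrite edge_pt. Qed.

Lemma arc_asym u v : D u v -> D v u -> False.
Proof.
by move=> uv vu; have := proj2 Dor _ _ (proj1 Dor _ _ uv); rewrite uv vu.
Qed.

Lemma bool_cases (k p : bool) : k = p \/ k = ~~ p.
Proof. by case: k p => -[]; auto. Qed.

(** Among the six positions of the middle vertex, adjacency to both ends leaves only [f]. The
    following lemmas enumerate in the same way. *)
Lemma step_ac i j : exists k, D (a i) (f k) /\ D (f k) (c j).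
Proof.
by case: (@two_step_pt 0 0 i 2 0 j) => // -[|[|[|?]]] [[|[|?]]] [k [// _ _ // *]]; exists k.
Qed.

Lemma step_ca i j : exists k, D (c i) (f k) /\ D (f k) (a j).
Proof.
by case: (@two_step_pt 2 0 i 0 0 j) => // -[|[|[|?]]] [[|[|?]]] [k [// _ _ // *]]; exists k.
Qed.

Lemma step_bd i j : exists k, D (b i) (e k) /\ D (e k) (d j).
Proof.
by case: (@two_step_pt 0 1 i 2 1 j) => // -[|[|[|?]]] [[|[|?]]] [k [// _ _ // *]]; exists k.
Qed.

Lemma step_db i j : exists k, D (d i) (e k) /\ D (e k) (b j).
Proof.
by case: (@two_step_pt 2 1 i 0 1 j) => // -[|[|[|?]]] [[|[|?]]] [k [// _ _ // *]]; exists k.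
Qed.

Lemma step_ce i j : exists k,
  D (c i) (d k) /\ D (d k) (e j) \/ D (c i) (f k) /\ D (f k) (e j).
Proof.
by case: (@two_step_pt 2 0 i 1 1 j) => // -[|[|[|?]]] [[|[|?]]] [k [// _ _ // *]];
  exists k; auto.
Qed.

Lemma step_ea i j : exists k,
  D (e i) (b k) /\ D (b k) (a j) \/ D (e i) (f k) /\ D (f k) (a j).
Proof.
by case: (@two_step_pt 1 1 i 0 0 j) => // -[|[|[|?]]] [[|[|?]]] [k [// _ _ // *]];
  exists k; auto.
Qed.

Lemma not_diam3 : False.
Proof.
have [p [ap pc]] := step_ac true true; have [q [cq qa]] := step_ca true true.
have Eq : q = ~~ p.
  by case: (bool_cases q p) => // E; rewrite E in qa; case: (arc_asym ap qa).
rewrite {}Eq in cq qa.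
have [r [br rd]] := step_bd true true; have [t [dt tb]] := step_db true true.
have Et : t = ~~ r.
  by case: (bool_cases t r) => // E; rewrite E in dt; case: (arc_asym dt rd).
rewrite {}Et in dt tb.
(* The other copy [e (~~ r)] cannot be the middle vertex, because its arcs with [d true] and
   [b true] run the opposite way. *)
have bE i : D (b i) (e r).
  have [k [bk kd]] := step_bd i true; case: (bool_cases k r) => E; rewrite E in bk kd.
    exact: bk.
  by case: (arc_asym kd dt).
have dE i : D (e r) (d i).
  have [k [bk kd]] := step_bd true i; case: (bool_cases k r) => E; rewrite E in bk kd.
    exact: kd.
  by case: (arc_asym bk tb).
(* [dE] excludes a passage from [c] to [e r] through [d], and [bE] one from [e r] to [a] through
   [b]; both walks must use [f]. *)
have [k [[_ /(arc_asym (dE k))//]|[ck kr]]] := step_ce true r.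
have [k' [[/(arc_asym (bE k'))//]|[rk' ka]]] := step_ea r true.
case: (bool_cases k p) => E; rewrite E in ck kr.
  exact: arc_asym ck pc.
case: (bool_cases k' p) => E'; rewrite E' in rk' ka.
  exact: arc_asym ap ka.
exact: arc_asym kr rk'.
Qed.

End P3P2.

Theorem theorem1p8 :
  class_C 1 (fun _ : cart (path_graph 3) (path_graph 2) => 2) /\
  (forall lambda mu : nat, 2 <= mu -> mu <= lambda ->
     ((4 <= lambda /\ mu = 2) \/ (3 <= mu /\ mu <= lambda) ->
      forall s : cart (path_graph lambda) (path_graph mu) -> nat,
        (forall v, 2 <= s v) -> class_C 0 s) /\
     (lambda = 3 /\ mu = 2 ->
      forall s : cart (path_graph lambda) (path_graph mu) -> nat,
        (forall v, 2 <= s v) -> class_C 0 s \/ class_C 1 s)).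
Proof.
split.
  apply: (good_class1 _ _ _ good32) => // D Dor _.
  by rewrite ltnNge; apply/negP => /(not_diam3 Dor).
move=> l m m2 ml; split=> [H s s2|[El Em]]; last first.
  by subst l m => s s2; apply: (good_class01 _ _ _ good32).
have l2 : 2 <= l := leq_trans m2 ml.
case: H => [[l4 Em]|[m3 _]].
  subst m; apply: (good_class0 _ _ _ (h := h4)) => //.
  by rewrite addn2 subn2; exact: good_l2.
apply: (good_class0 _ _ _ (h := h3)) => //.
by apply: good_lm => //; apply: leq_trans ml.
Qed.
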